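(* Consider the off-policy soft Bellman backup operator $\mathcal{T}$ given, for $\mathbf{s}\in\mathcal{S}$ and $\mathbf{a}\in\mathcal{A}_\succ(\mathbf{s})$, by $$\mathcal{T}Q(\mathbf{s},\mathbf{a}) \triangleq r(\mathbf{s},\mathbf{a}) + \gamma\,\mathbb{E}_{\mathbf{s}'\sim p_s(\cdot\mid\mathbf{s},\mathbf{a})}\Big[\log\int_{\mathcal{A}_\succ(\mathbf{s}')}\exp\big(Q(\mathbf{s}',\mathbf{a}')\big)\,d\mathbf{a}'\Big],$$ where $r=r_n$ is the scalar reward of subtask $n$. Let $Q^0:\mathcal{S}\times\mathcal{A}_\succ\to\mathbb{R}$ be an initial mapping, with $|\mathcal{A}_\succ|<\infty$, and define $Q^{l+1}=\mathcal{T}Q^{l}$. Then the sequence of $Q^l$ converges to $Q^*_\succ$, the soft Q-value of the optimal arbiter policy $\pi^*_\succ$, as $l\to\infty$.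
   Context: Setting: a Markov decision process with state space $\mathcal{S}$, action space $\mathcal{A}$, transition distribution $p_s(\mathbf{s}_{t+1}\mid\mathbf{s}_t,\mathbf{a}_t)$, discount factor $\gamma\in[0,1]$, and $n$ subtasks with scalar rewards $r_1,\dots,r_n:\mathcal{S}\times\mathcal{A}\to\mathbb{R}$ ranked by priority $1\succ 2\succ\dots\succ n$ (1 highest, $n$ lowest). Here $\rho_\pi$ denotes the state-action marginal (trajectory distribution) induced by a policy $\pi(\mathbf{a}_t\mid\mathbf{s}_t)$. Priority constraints: the Q-functions $Q_1,\dots,Q_{n-1}:\mathcal{S}\times\mathcal{A}\to\mathbb{R}$ of the higher-priority subtasks have already been learned and are held fixed, and thresholds $\varepsilon_1,\dots,\varepsilon_{n-1}\ge 0$ are given. Put $c_i(\mathbf{s},\mathbf{a})=1$ if $\max_{\mathbf{a}'\in\mathcal{A}}Q_i(\mathbf{s},\mathbf{a}')-Q_i(\mathbf{s},\mathbf{a})\le\varepsilon_i$ and $c_i(\mathbf{s},\mathbf{a})=0$ otherwise. The global action indifference space at $\mathbf{s}$ is $\mathcal{A}_\succ(\mathbf{s})=\{\mathbf{a}\in\mathcal{A}: c_i(\mathbf{s},\mathbf{a})=1\text{ for all }i=1,\dots,n-1\}$, which is nonempty. The symbol $\mathcal{A}_\succ$ without argument stands for this state-dependent action space, so a mapping on $\mathcal{S}\times\mathcal{A}_\succ$ is defined at pairs $(\mathbf{s},\mathbf{a})$ with $\mathbf{a}\in\mathcal{A}_\succ(\mathbf{s})$, and $|\mathcal{A}_\succ|<\infty$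 is the finiteness assumption on this action space. Arbiter policies: an arbiter policy is a policy that never selects actions outside $\mathcal{A}_\succ(\mathbf{s})$ in any state $\mathbf{s}$. The entropy of a policy is $\mathcal{H}(\pi(\cdot\mid\mathbf{s}))=\mathbb{E}_{\mathbf{a}\sim\pi(\cdot\mid\mathbf{s})}[-\log\pi(\mathbf{a}\mid\mathbf{s})]$. The optimal arbiter policy $\pi^*_\succ$ is the maximum-entropy optimal policy among arbiter policies, i.e. the one maximizing $$\sum_{t=1}^\infty\mathbb{E}_{(\mathbf{s}_t,\mathbf{a}_t)\sim\rho_\pi}\big[\gamma^{t-1}\big(r_n(\mathbf{s}_t,\mathbf{a}_t)+\mathcal{H}(\pi(\cdot\mid\mathbf{s}_t))\big)\big].$$ Its soft Q-value is, for $\mathbf{a}_t\in\mathcal{A}_\succ(\mathbf{s}_t)$, $$Q^*_\succ(\mathbf{s}_t,\mathbf{a}_t)=r_n(\mathbf{s}_t,\mathbf{a}_t)+\mathbb{E}_{(\mathbf{s}_{t+1},\mathbf{a}_{t+1},\dots)\sim\rho_{\pi^*_\succ}}\Big[\sum_{l=1}^\infty\gamma^l\big(r_n(\mathbf{s}_{t+l},\mathbf{a}_{t+l})+\mathcal{H}(\pi^*_\succ(\cdot\mid\mathbf{s}_{t+l}))\big)\Big].$$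
   Formalization: The discount is restricted to 0 ≤ γ < 1 (the claim fails at γ = 1), r_n and Q^0 are assumed bounded and measurable on pairs with a in A_≻(s), and |A_≻| < ∞ is read as volumes of A_≻(s) bounded above and away from 0 uniformly in s. *)

(* Defs.v *)
From HB Require Import structures.
From mathcomp Require Import all_boot all_order all_algebra.
From mathcomp Require Import all_classical all_reals all_analysis.

Set Implicit Arguments.
Unset Strict Implicit.
Unset Printing Implicit Defensive.

Import Order.TTheory GRing.Theory Num.Theory.
Import numFieldNormedType.Exports.

Local Open Scope classical_set_scope.
Local Open Scope ring_scope.

(** Throughout, [S] and [A] are the state and action spaces, [nu] is the
    reference measure "da" on actions (counting measure for discrete actions,
    Lebesgue measure for continuous ones) and [p] is the transition kernel. *)

(** [c_i(s, a)], a truth value.  The maximum is rendered by [sup], hence is only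
    meaningful where [q (s, _)] attains its maximum. *)
Definition constraint (R : realType) (S A : Type) (q : S * A -> R) (eps : R)
    (s : S) (a : A) : bool :=
  sup [set q (s, a') | a' in [set: A]] - q (s, a) <= eps.

(** [A_>(s)]. *)
Definition indifference (R : realType) (S A : Type) (m : nat)
    (q : 'I_m -> S * A -> R) (eps : 'I_m -> R) (s : S) : set A :=
  [set a | forall i, constraint (q i) (eps i) s a].

(** The pairs [(s, a)] with [a \in D s]. *)
Definition graph_of (S A : Type) (D : S -> set A) : set (S * A) :=
  [set x | D x.1 x.2].

(** [|D| < oo], uniformly in the state and with respect to [nu].  The lower bound
    is automatic for nonempty sets under counting measure; for a general [nu]
    it is what keeps [log (nu (D s))] bounded. *)
Definition finite_volume (R : realType) (S : Type) (dA : measure_display)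
    (A : measurableType dA) (nu : {measure set A -> \bar R})
    (D : S -> set A) : Prop :=
  exists lo hi : R, 0 < lo /\
    forall s, (lo%:E <= nu (D s))%E /\ (nu (D s) <= hi%:E)%E.

(** Stationary stochastic policies.  The number [pi(a|s)] occurring in the entropy
    is the density of the policy with respect to [nu]. *)
Record policy (R : realType) (dS dA : measure_display)
    (S : measurableType dS) (A : measurableType dA)
    (nu : {measure set A -> \bar R}) := Policy {
  pol :> R.-pker S ~> A ;
  dens : S * A -> R ;
  dens_measurable : measurable_fun [set: S * A] dens ;
  dens_ge0 : forall x, 0 <= dens x ;
  pol_dens : forall s B, measurable B ->
    pol s B = (\int[nu]_(a in B) (dens (s, a))%:E)%E }.

Section MDP.
Context {R : realType} {dS dA : measure_display}.
Context {S : measurableType dS} {A : measurableType dA}.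
Context {nu : {measure set A -> \bar R}}.

Implicit Types (pi : policy S nu) (D : S -> set A) (p : R.-pker (S * A) ~> S).

Definition arbiter D pi : Prop := forall s, pi s (~` D s) = 0%E.

(** Possibly [-oo] when [nu] is not discrete. *)
Definition entropy pi (s : S) : \bar R :=
  (\int[pi s]_a (- ln (dens pi (s, a)))%:E)%E.

Definition kid : R.-pker (S * A) ~> (S * A)%type :=
  kdirac (@measurable_id _ (S * A)%type setT).

(** The law of [(s, a)] when [a] is drawn from [pi(.|s)]. *)
Definition draw pi : S -> {measure set (S * A) -> \bar R} := mkcomp pi kid.

HB.instance Definition _ pi := Kernel.copy (draw pi) (mkcomp pi kid).

Lemma draw_setT pi s : draw pi s [set: (S * A)%type] = 1%E.
Proof.
transitivity (\int[pi s]_a kid (s, a) setT)%E; first by [].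
under eq_integral do rewrite prob_kernel.
by rewrite integral_cst//= prob_kernel mule1.
Qed.

HB.instance Definition _ pi :=
  Kernel_isProbability.Build _ _ _ _ _ (draw pi) (draw_setT pi).

(** One step [(s, a) |-> (s', a')] of the state-action chain. *)
Definition sa_step p pi : R.-spker (S * A) ~> (S * A)%type :=
  mkcomp_noparam p (draw pi).

(** Law of the state-action pair [t] steps after a start drawn from [init]. *)
Fixpoint sa_marginal p pi (dX : measure_display) (X : measurableType dX)
    (init : R.-spker X ~> (S * A)%type) (t : nat) : R.-spker X ~> (S * A)%type :=
  if t is t'.+1 then mkcomp_noparam (sa_marginal p pi init t') (sa_step p pi)
  else init.

(** [gamma^t * (r + H)]: the entropy-augmented reward at time offset [t]. *)
Definition soft_reward (r : S * A -> R) (gamma : R) pi (t : nat)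
    (x : S * A) : \bar R :=
  ((gamma ^+ t)%:E * ((r x)%:E + entropy pi x.1))%E.

(** Maximum-entropy objective from the initial state [s]; the index [t] here is
    the [t - 1] of the usual sum over [t >= 1]. *)
Definition objective p (r : S * A -> R) (gamma : R) pi (s : S) : \bar R :=
  (\sum_(0 <= t <oo)
     \int[sa_marginal p pi (draw pi) t s]_x soft_reward r gamma pi t x)%E.

(** Optimality is required from every initial state: a policy optimal for one
    initial state only is unconstrained at the states it does not reach. *)
Definition optimal_arbiter p (r : S * A -> R) (gamma : R) D pi : Prop :=
  arbiter D pi /\
  forall pi', arbiter D pi' ->
    forall s, (objective p r gamma pi' s <= objective p r gamma pi s)%E.

Definition soft_value p (r : S * A -> R) (gamma : R) pi (x : S * A) : \bar R :=
  ((r x)%:E + \sum_(1 <= l <oo)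
     \int[sa_marginal p pi kid l x]_y soft_reward r gamma pi l y)%E.

End MDP.

(** Soft Bellman backup; only the values of [Q] on [graph_of D] are used. *)
Definition soft_backup (R : realType) (dS dA : measure_display)
    (S : measurableType dS) (A : measurableType dA)
    (nu : {measure set A -> \bar R}) (p : R.-pker (S * A) ~> S)
    (r : S * A -> R) (gamma : R) (D : S -> set A)
    (Q : S * A -> R) (x : S * A) : R :=
  r x + gamma *
    \int[p x]_s' ln (\int[nu]_(a' in D s') expR (Q (s', a'))).

(* Main.v *)
Require Import Defs.
From HB Require Import structures.
From mathcomp Require Import all_boot all_order all_algebra.
From mathcomp Require Import all_classical all_reals all_analysis.
From mathcomp Require Import measurable_realfun ring lra.

Set Implicit Arguments.
Unset Strict Implicit.
Unset Printing Implicit Defensive.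

Import Order.TTheory GRing.Theory Num.Theory.
Import numFieldNormedType.Exports.

Local Open Scope classical_set_scope.
Local Open Scope ring_scope.

(** The backup is a [gamma]-contraction for the supremum norm over the graph of
    the indifference space, so its iterates converge uniformly, at geometric
    rate, to a fixed point [Qs].  Let [V s = ln (\int exp (Qs (s, .)))].
    Jensen's inequality (Gibbs' variational principle) says that every arbiter
    policy has [entropy + mean of Qs <= V], with equality for the softmax policy
    of density [exp (Qs - V)]; iterating this along the Markov chain bounds the
    objective of every arbiter policy by [V], and the softmax policy attains
    [V].  The soft value of a policy is obtained from its objective by one
    Bellman step, so all optimal policies share the soft value
    [r + gamma * E V = Qs]. *)

(** * Integration *)

Section integral_against_mixtures.
Local Open Scope ereal_scope.
Import HBNNSimple.
Context {R : realType}.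

Let limn_nnsfun_approx d (Y : measurableType d) (f : Y -> \bar R)
    (mf : measurable_fun [set: Y] f) (mu : {measure set Y -> \bar R}) :
  (forall y, 0 <= f y) ->
  \int[mu]_y f y =
  limn (fun n => \int[mu]_y (nnsfun_approx measurableT mf n y)%:E).
Proof.
move=> f0; set f_ := nnsfun_approx measurableT mf.
rewrite -monotone_convergence//; last 3 first.
- by move=> n; exact/measurable_EFinP.
- by move=> n x _; rewrite lee_fin.
- by move=> x _ m n mn; rewrite lee_fin; exact/lefP/nd_nnsfun_approx.
apply: eq_integral => y _; apply/esym/cvg_lim => //.
exact: cvg_nnsfun_approx.
Qed.

(** For simple functions this is linearity over the finitely many values; increasing simple
    approximations and monotone convergence, applied in both integrals, give the rest. Asking only
    for the identity on measurable sets lets it serve kernel compositions and densities alike. *)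
Lemma ge0_integral_mixture d d' (X : measurableType d) (Y : measurableType d')
    (mu : {measure set Y -> \bar R}) (l : {measure set X -> \bar R})
    (k : X -> {measure set Y -> \bar R}) (f : Y -> \bar R) :
  (forall U, measurable U -> measurable_fun [set: X] (k ^~ U)) ->
  (forall U, measurable U -> mu U = \int[l]_x k x U) ->
  (forall y, 0 <= f y) -> measurable_fun [set: Y] f ->
  \int[mu]_y f y = \int[l]_x \int[k x]_y f y.
Proof.
move=> mk muE f0 mf; pose f_ := nnsfun_approx measurableT mf.
have nnsfunE (g : {nnsfun Y >-> R}) :
    \int[mu]_y (g y)%:E = \int[l]_x \int[k x]_y (g y)%:E.
  rewrite integralT_nnsfun sintegralE.
  under [in RHS]eq_integral do rewrite integralT_nnsfun sintegralE.
  rewrite ge0_integral_fsum//; last 2 first.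
  - by move=> r; apply: measurable_funeM; exact: mk.
  - by move=> r x _; exact: nnsfun_mulemu_ge0.
  apply: eq_fsbigr => r; rewrite inE => -[y _ <-].
  rewrite muE// ge0_integralZl//; first exact: mk.
  by rewrite lee_fin.
have mint n : measurable_fun [set: X] (fun x => \int[k x]_y (f_ n y)%:E).
  apply: measurable_fun_integral_kernel => //.
  - by move=> z; rewrite lee_fin.
  - exact/measurable_EFinP.
transitivity (limn (fun n => \int[mu]_y (f_ n y)%:E)).
  exact: limn_nnsfun_approx.
under eq_fun do rewrite nnsfunE.
rewrite -monotone_convergence//; last 2 first.
- by move=> n x _; apply: integral_ge0 => y _; rewrite lee_fin.
- move=> x _ m n mn; apply: ge0_le_integral => //.
  + by move=> y _; rewrite lee_fin.
  + exact/measurable_EFinP.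
  + exact/measurable_EFinP.
  + by move=> y _; rewrite lee_fin; exact/lefP/nd_nnsfun_approx.
by apply: eq_integral => x _; exact/esym/limn_nnsfun_approx.
Qed.

(* The density measure is the mixture of the point masses [g x * \d_ x]. *)
Lemma ge0_integral_density d (X : measurableType d)
    (mu nu : {measure set X -> \bar R}) (g : X -> R) (f : X -> \bar R) :
  measurable_fun [set: X] g -> (forall x, 0 <= g x)%R ->
  (forall U, measurable U -> mu U = \int[nu]_(x in U) (g x)%:E) ->
  (forall x, 0 <= f x) -> measurable_fun [set: X] f ->
  \int[mu]_x f x = \int[nu]_x ((g x)%:E * f x).
Proof.
move=> mg g0 muE f0 mf.
rewrite (@ge0_integral_mixture _ _ _ _ mu nu
  (fun x => mscale (NngNum (g0 x)) (dirac x)))//.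
- apply: eq_integral => x _.
  by rewrite ge0_integral_mscale// integral_dirac// diracT mul1e.
- move=> U mU; apply: emeasurable_funM; first exact/measurable_EFinP.
  by apply/measurable_EFinP; exact: measurable_indic.
- move=> U mU; rewrite muE// integral_mkcond; apply: eq_integral => x _.
  rewrite [RHS](_ : _ = (g x)%:E * (\1_U x)%:E)// indicE patchE.
  by case: ifPn => _; rewrite ?mule1 ?mule0.
Qed.

End integral_against_mixtures.

(** No integrability is assumed, so the integrals may be infinite: positive parts grow, negative
    parts shrink, and extended subtraction respects both. It is applied to [- ln] of a policy
    density. *)
Lemma le_integral_measurable d (T : measurableType d) (R : realType)
    (mu : {measure set T -> \bar R}) (f g : T -> \bar R) :
  measurable_fun [set: T] f -> measurable_fun [set: T] g ->
  (forall x, (f x <= g x)%E) ->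
  (\int[mu]_x f x <= \int[mu]_x g x)%E.
Proof.
move=> mf mg fg; rewrite integralE [leRHS]integralE leeB//.
- apply: ge0_le_integral => //; try exact: measurable_funepos.
  by move=> x _; apply: (@funepos_le _ _ setT) => //; rewrite inE.
- apply: ge0_le_integral => //; try exact: measurable_funeneg.
  by move=> x _; apply: (@funeneg_le _ _ setT) => //; rewrite inE.
Qed.

Lemma nneseries_shift1 (R : realType) (f : nat -> \bar R) :
  (forall k, (0 <= f k)%E) ->
  (\sum_(1 <= k <oo) f k = \sum_(0 <= k <oo) f k.+1)%E.
Proof.
move=> f0; apply/esym/cvg_lim => //.
have c : (\sum_(1 <= k < n) f k @[n --> \oo] --> \sum_(1 <= k <oo) f k)%E.
  by apply: is_cvg_nneseries => k _ _; exact: f0.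
have E n : (\sum_(0 <= k < n) f k.+1 = \sum_(1 <= k < n.+1) f k)%E.
  by rewrite big_add1.
by rewrite -cvg_shiftS in c; under eq_fun do rewrite E.
Qed.

(** * Extended-valued integrands and discounted series bounded above *)

Section bounded_above.
Local Open Scope ereal_scope.
Context {R : realType}.

(** If the nonnegative function [B - f] has finite integral, this is linearity. Otherwise
    [B - f <= f^\- + |B|] forces the negative part of [f] to have infinite integral while its
    positive part is at most [|B|], so both sides are [-oo]. *)
Lemma integral_bounded_above d (T : measurableType d)
    (mu : {measure set T -> \bar R}) (f : T -> \bar R) (B : R) :
  mu [set: T] = 1 -> measurable_fun [set: T] f ->
  (forall x, f x <= B%:E) ->
  \int[mu]_x f x = B%:E - \int[mu]_x (B%:E - f x).
Proof.
move=> mu1 mf fB; pose g x := B%:E - f x.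
have g0 x : 0 <= g x by rewrite sube_ge0 ?orbT.
have mg : measurable_fun [set: T] g by exact: emeasurable_funB.
have intB (b : R) : \int[mu]_x b%:E = b%:E.
  by rewrite (integral_cst mu measurableT b%:E) mu1 mule1.
have iB (b : R) : mu.-integrable [set: T] (cst b%:E).
  apply/integrableP; split=> //=.
  by rewrite (integral_cst mu measurableT) mu1 mule1 ltry.
have [ig|ig] := ltP (\int[mu]_x g x) +oo.
  have gi : mu.-integrable [set: T] g.
    apply/integrableP; split=> //.
    by under eq_integral do rewrite gee0_abs//.
  rewrite (_ : \int[mu]_x f x = \int[mu]_x (cst B%:E x - g x)); last first.
    apply: eq_integral => x _; rewrite /g/=.
    by case: (f x) (fB x) => [r||]//= _; rewrite -!EFinB opprB addrC subrK.
  by rewrite integralB// intB.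
have {}ig : \int[mu]_x g x = +oo by apply/eqP; move: ig; rewrite leye_eq.
have fn : \int[mu]_x f^\- x = +oo.
  have : \int[mu]_x g x <= \int[mu]_x (f^\- x + `|B|%:E).
    apply: ge0_le_integral => //.
    - by apply: emeasurable_funD => //; exact: measurable_funeneg.
    - move=> x _; rewrite /g addeC leeD//.
        by rewrite lee_fin ler_norm.
      by rewrite funenegE le_max lexx.
  rewrite ig leye_eq ge0_integralD//; last exact: measurable_funeneg.
  by rewrite intB; case: (\int[mu]_x f^\- x).
have fp : \int[mu]_x f^\+ x < +oo.
  apply: (@le_lt_trans _ _ (\int[mu]_x `|B|%:E)); last by rewrite intB ltry.
  apply: ge0_le_integral => //; first exact: measurable_funepos.
  move=> x _; rewrite funeposE ge_max lee_fin normr_ge0 andbT.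
  by rewrite (le_trans (fB x))// lee_fin ler_norm.
rewrite integralE fn ig; have : 0 <= \int[mu]_x f^\+ x by exact: integral_ge0.
by case: (\int[mu]_x f^\+ x) fp.
Qed.

(** The constant part is a geometric tail. The subtraction splits on partial sums and in the limit
    because that part is finite, even where [G] takes the value [+oo]. *)
Lemma discounted_sumB (B gamma : R) (G : nat -> \bar R) (m : nat) :
  (0 <= gamma < 1)%R -> (forall t, 0 <= G t) ->
  \sum_(m <= t <oo) (gamma ^+ t)%:E * (B%:E - G t) =
  (gamma ^+ m * B / (1 - gamma))%:E - \sum_(m <= t <oo) (gamma ^+ t)%:E * G t.
Proof.
move=> /andP[ga0 ga1] G0.
have ga_t t : (0 <= gamma ^+ t)%R by exact: exprn_ge0.
have ga1' : (1 - gamma)%R != 0%R by rewrite subr_eq0 eq_sym lt_eqF.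
have part n : (m <= n)%N ->
    \sum_(m <= t < n) (gamma ^+ t)%:E * (B%:E - G t) =
    ((gamma ^+ m - gamma ^+ n) * B / (1 - gamma))%:E -
      \sum_(m <= t < n) (gamma ^+ t)%:E * G t.
  move=> mn; rewrite -(subnKC mn); elim: (n - m)%N => [|k ih].
    by rewrite addn0 !big_geq// subrr !mul0r sube0.
  rewrite addnS !big_nat_recr ?leq_addr//= ih muleBr ?fin_num_adde_defr//.
  rewrite -EFinM oppeD ?ge0_adde_def ?inE ?sume_ge0//; last 2 first.
  - by move=> t _; rewrite mule_ge0 ?lee_fin.
  - by rewrite mule_ge0 ?lee_fin.
  rewrite addeACA -EFinD; congr (_%:E + _).
  by rewrite exprS; field.
have cG : cvgn (fun n => \sum_(m <= t < n) (gamma ^+ t)%:E * G t).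
  by apply: is_cvg_nneseries => t _ _; rewrite mule_ge0 ?lee_fin.
apply/cvg_lim => //.
have c1 : ((gamma ^+ m - gamma ^+ n) * B / (1 - gamma))%:E @[n --> \oo] -->
    (gamma ^+ m * B / (1 - gamma))%:E.
  apply: cvg_EFin; first by near=> n.
  have : ((gamma ^+ m - gamma ^+ n) * (B / (1 - gamma)))%R @[n --> \oo] -->
      ((gamma ^+ m - 0) * (B / (1 - gamma)))%R.
    apply: cvgM; last exact: cvg_cst.
    apply: cvgB; first exact: cvg_cst.
    by apply: cvg_expr; rewrite ger0_norm.
  by rewrite subr0 mulrA; under eq_fun do rewrite mulrA.
apply: cvg_trans (cvgeB _ c1 cG); last by rewrite fin_num_adde_defr.
apply: near_eq_cvg; near=> n; rewrite /= part//.
by near: n; exact: nbhs_infty_ge.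
Unshelve. all: by end_near. Qed.

End bounded_above.

(** * Bounded functions integrated against probability kernels *)

Section bounded_functions.
Context {R : realType} {dX dY : measure_display}.
Context {X : measurableType dX} {Y : measurableType dY}.
Variable k : R.-pker X ~> Y.
Implicit Types (f g : Y -> R) (M e : R).

Lemma integrable_prob_kernel f M x : measurable_fun [set: Y] f ->
  (forall y, `|f y| <= M) -> (k x).-integrable [set: Y] (EFin \o f).
Proof.
move=> mf fM; apply: measurable_bounded_integrable => //.
  by rewrite prob_kernel ltry.
exists M; split; rewrite ?num_real// => N MN y _ /=.
by rewrite (le_trans (fM y))// ltW.
Qed.

Lemma EFin_Rintegral_prob_kernel f M x : measurable_fun [set: Y] f ->
  (forall y, `|f y| <= M) -> (\int[k x]_y f y)%:E = (\int[k x]_y (f y)%:E)%E.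
Proof.
move=> mf fM; rewrite fineK//; apply: integrable_fin_num => //.
exact: integrable_prob_kernel fM.
Qed.

Lemma Rintegral_prob_kernel_cst e x : \int[k x]__ e = e.
Proof. by rewrite Rintegral_cst// prob_kernel mulr1. Qed.

(** The additive slack [e] survives integration unchanged since the total mass is [1]; this is how
    sup-norm estimates pass through an expectation. *)
Lemma le_Rintegral_prob_kernel f g M N e x :
  measurable_fun [set: Y] f -> (forall y, `|f y| <= M) ->
  measurable_fun [set: Y] g -> (forall y, `|g y| <= N) ->
  (forall y, f y <= g y + e) -> \int[k x]_y f y <= \int[k x]_y g y + e.
Proof.
move=> mf fM mg gN fg.
rewrite -[X in _ <= _ + X](Rintegral_prob_kernel_cst e x).
have ie : (k x).-integrable [set: Y] (EFin \o cst e).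
  by apply: (@integrable_prob_kernel _ `|e|) => //.
have ig := integrable_prob_kernel x mg gN.
rewrite -RintegralD//; apply: le_Rintegral => //.
- exact: integrable_prob_kernel fM.
- by rewrite /comp; under eq_fun do rewrite EFinD; exact: integrableD.
Qed.

Lemma normr_Rintegral_prob_kernel f M x : measurable_fun [set: Y] f ->
  (forall y, `|f y| <= M) -> `|\int[k x]_y f y| <= M.
Proof.
move=> mf fM.
have m0 : measurable_fun [set: Y] (fun=> 0 : R) by [].
have b0 (y : Y) : `|0 : R| <= 0 by rewrite normr0.
have h1 : \int[k x]__ 0 <= \int[k x]_y f y + M.
  by apply: (@le_Rintegral_prob_kernel (fun=> 0) f 0 M M x m0 b0 mf fM) => y;
    move: (fM y); rewrite ler_norml -lerBlDr sub0r => /andP[].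
have h2 : \int[k x]_y f y <= \int[k x]__ 0 + M.
  by apply: (@le_Rintegral_prob_kernel f (fun=> 0) M 0 M x mf fM m0 b0) => y;
    move: (fM y); rewrite ler_norml add0r => /andP[].
move: h1 h2; rewrite Rintegral_prob_kernel_cst ler_norml add0r => h1 ->.
by rewrite andbT -sub0r lerBlDr.
Qed.

Lemma measurable_Rintegral_prob_kernel f M : measurable_fun [set: Y] f ->
  (forall y, `|f y| <= M) -> measurable_fun [set: X] (fun x => \int[k x]_y f y).
Proof.
move=> mf fM.
(* Adding [M] makes the integrand nonnegative, the case in which integration against a kernel is
   known to preserve measurability. *)
rewrite (_ : (fun x => _) = (fun x => fine (\int[k x]_y (f y + M)%:E)%E - M)).
  apply: measurable_funB => //; apply: measurableT_comp => //.
  apply: measurable_fun_integral_kernel.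
  - exact: measurable_kernel.
  - by move=> y; rewrite lee_fin; move: (fM y); rewrite ler_norml; lra.
  - by apply/measurable_EFinP; exact: measurable_funD.
apply/funext => x; have im := integrable_prob_kernel x mf fM.
rewrite -[fine _]/(\int[k x]_y (f y + cst M y)) RintegralD//.
  by rewrite Rintegral_prob_kernel_cst addrK.
by apply: (@integrable_prob_kernel _ `|M|).
Qed.

End bounded_functions.

(** * Soft maximum and soft backup *)

Lemma mem_graph_of (S A : Type) (D : S -> set A) s a :
  ((s, a) \in graph_of D) = (a \in D s).
Proof. by apply/idP/idP; rewrite !inE. Qed.

Section soft_maximum.
Context {R : realType} {dS dA : measure_display}.
Context {S : measurableType dS} {A : measurableType dA}.
Variable nu : {sigma_finite_measure set A -> \bar R}.
Variable D : S -> set A.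
Hypothesis mD : measurable (graph_of D).
Variables lo hi : R.
Hypothesis lo0 : 0 < lo.
Hypothesis volD : forall s, (lo%:E <= nu (D s))%E /\ (nu (D s) <= hi%:E)%E.
Implicit Types (Q : S * A -> R) (K e : R) (s : S).

(** The ball of radius [K] on which the backup acts. Nothing is required off the graph, where the
    initial mapping is arbitrary. *)
Definition admissible K Q :=
  measurable_fun (graph_of D) Q /\ forall x, graph_of D x -> `|Q x| <= K.

Definition soft_maximum Q s : R := ln (\int[nu]_(a in D s) expR (Q (s, a))).

(** A bound for [|ln (nu (D s))|] uniform in [s], as the volume lies between [lo] and [hi]. *)
Definition log_volume_bound : R := `|ln lo| + `|ln hi|.

Let L := log_volume_bound.

Lemma measurable_section s : measurable (D s).
Proof.
rewrite (_ : D s = xsection (graph_of D) s); first exact: measurable_xsection.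
by apply/seteqP; split=> a; rewrite /xsection/= inE.
Qed.

Lemma measurable_fun_section K Q s : admissible K Q ->
  measurable_fun (D s) (fun a => Q (s, a)).
Proof.
move=> [mQ _].
apply: (@measurable_comp _ _ _ _ _ _ _ Q (D s) (pair s) mD) => //.
- by move=> _ [a Da <-].
- exact/measurable_funTS/pair1_measurable.
Qed.

Lemma measurable_expR_section K Q s : admissible K Q ->
  measurable_fun (D s) (fun a => (expR (Q (s, a)))%:E).
Proof.
move=> /measurable_fun_section mQ; apply/measurable_EFinP.
exact: measurableT_comp.
Qed.

Lemma integral_expR_bounds K Q s : admissible K Q ->
  ((expR (- K) * lo)%:E <= \int[nu]_(a in D s) (expR (Q (s, a)))%:E <=
   (expR K * hi)%:E)%E.
Proof.
move=> gQ; have [_ QK] := gQ; have mDs := measurable_section s.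
have [lonu nuhi] := volD s.
apply/andP; split.
- apply: (@le_trans _ _ (\int[nu]_(a in D s) (cst (expR (- K))%:E a))%E).
    by rewrite integral_cst// EFinM lee_pmul// ?lee_fin ?expR_ge0// ltW.
  apply: ge0_le_integral => //.
  + by move=> a _; rewrite lee_fin expR_ge0.
  + exact: measurable_expR_section gQ.
  + move=> a Da; rewrite lee_fin ler_expR.
    by have := QK (s, a) Da; rewrite ler_norml => /andP[].
- apply: (@le_trans _ _ (\int[nu]_(a in D s) (cst (expR K)%:E a))%E).
    apply: ge0_le_integral => //.
    + exact: measurable_expR_section gQ.
    + move=> a Da; rewrite lee_fin ler_expR.
      by have := QK (s, a) Da; rewrite ler_norml => /andP[].
  by rewrite integral_cst// EFinM lee_pmul2l// lte_fin expR_gt0.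
Qed.

Lemma expR_soft_maximum K Q s : admissible K Q ->
  ((expR (soft_maximum Q s))%:E =
   \int[nu]_(a in D s) (expR (Q (s, a)))%:E)%E.
Proof.
move=> gQ; have /andP[lb ub] := integral_expR_bounds s gQ.
have fn : (\int[nu]_(a in D s) (expR (Q (s, a)))%:E)%E \is a fin_num.
  rewrite ge0_fin_numE ?(le_lt_trans ub) ?ltry//.
  by apply: integral_ge0 => a _; rewrite lee_fin expR_ge0.
rewrite lnK ?fineK// posrE -lte_fin fineK// (lt_le_trans _ lb)// lte_fin.
by rewrite mulr_gt0// expR_gt0.
Qed.

(** Shifting [Q'] by [e] multiplies the integral of its exponential by [expR e]: log-integral-exp is
    monotone and commutes with adding constants, hence is nonexpansive in the supremum norm. *)
Lemma le_soft_maximum K K' Q Q' e s : admissible K Q -> admissible K' Q' ->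
  (forall a, D s a -> Q (s, a) <= Q' (s, a) + e) ->
  soft_maximum Q s <= soft_maximum Q' s + e.
Proof.
move=> gQ gQ' QQ'; rewrite -ler_expR -lee_fin expRD mulrC EFinM.
rewrite [X in (X <= _)%E](expR_soft_maximum s gQ).
rewrite [X in (_ * X)%E](expR_soft_maximum s gQ').
have mDs := measurable_section s.
rewrite -ge0_integralZl//; last exact: measurable_expR_section gQ'.
apply: ge0_le_integral => //.
- exact: measurable_expR_section gQ.
- by apply: measurable_funeM; exact: measurable_expR_section gQ'.
- by move=> a Da; rewrite -EFinM -expRD lee_fin ler_expR addrC QQ'.
Qed.

Lemma normr_soft_maximum K Q s : admissible K Q -> `|soft_maximum Q s| <= K + L.
Proof.
move=> gQ; have /andP[] := integral_expR_bounds s gQ.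
have hi0 : 0 < hi.
  have [h1 h2] := volD s; rewrite -lte_fin (lt_le_trans _ h2)//.
  by rewrite (lt_le_trans _ h1).
rewrite -(expR_soft_maximum s gQ) !lee_fin.
rewrite -{1}[lo](@lnK R) ?posrE// -{1}[hi](@lnK R) ?posrE//.
rewrite -!expRD !ler_expR => h1 h2; rewrite ler_norml /L /log_volume_bound.
move: (ler_norm (ln hi)) (ler_norm (- ln lo)).
move: (normr_ge0 (ln hi)) (normr_ge0 (ln lo)).
by rewrite normrN; lra.
Qed.

Lemma measurable_soft_maximum K Q : admissible K Q ->
  measurable_fun [set: S] (soft_maximum Q).
Proof.
move=> [mQ _]; apply: measurableT_comp => //; apply: measurableT_comp => //.
(* Extension by zero turns an integral over the varying set [D s] into a section integral on the
   product, measurable in [s] by Tonelli. *)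
pose f := (fun x => (expR (Q x))%:E) \_ (graph_of D).
rewrite (_ : (fun s => _) = fubini_F nu f).
  apply: measurable_fun_fubini_tonelli_F.
  - apply/(measurable_restrictT _ mD)/measurable_EFinP.
    exact: measurableT_comp.
  - by move=> x; rewrite /f patchE; case: ifPn.
apply/funext => s; rewrite /fubini_F integral_mkcond.
apply: eq_integral => a _; rewrite /f !patchE.
by rewrite mem_graph_of.
Qed.

(** * The soft backup as a contraction, and its fixed point *)

Variable p : R.-pker (S * A) ~> S.
Variables (gamma : R) (r : S * A -> R) (rmax : R).
Hypothesis gamma01 : 0 <= gamma < 1.
Hypothesis mr : measurable_fun [set: S * A] r.
Hypothesis rb : forall x, graph_of D x -> `|r x| <= rmax.

Let T := soft_backup nu p r gamma D.

Let gamma0 : 0 <= gamma. Proof. by case/andP: gamma01. Qed.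
Let gamma1 : gamma < 1. Proof. by case/andP: gamma01. Qed.

Lemma soft_backupE Q x :
  T Q x = r x + gamma * \int[p x]_s soft_maximum Q s.
Proof. by []. Qed.

(** The inequality on [K] says that the ball of radius [K] is mapped into itself: the soft maximum
    costs at most [L] beyond [K], and the reward at most [rmax]. *)
Lemma admissible_soft_backup K Q : rmax + gamma * (K + L) <= K ->
  admissible K Q -> admissible K (T Q).
Proof.
move=> stable gQ; have msm := measurable_soft_maximum gQ.
have bsm := (fun s => normr_soft_maximum s gQ).
split.
- apply: measurable_funD; first exact: measurable_funTS.
  apply: measurable_funM => //; apply: measurable_funTS.
  exact: measurable_Rintegral_prob_kernel bsm.
- move=> x Dx; rewrite soft_backupE (le_trans (ler_normD _ _))//.
  apply: le_trans stable; rewrite lerD ?rb// normrM ger0_norm// ler_wpM2l//.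
  exact: normr_Rintegral_prob_kernel.
Qed.

(** The rewards cancel, and the soft maximum and the expectation are both nonexpansive, so only the
    factor [gamma] remains. Closeness on the graph gives closeness at every pair, since the backup
    reads [Q] on the graph only. *)
Lemma soft_backup_contraction K Q Q' e : admissible K Q -> admissible K Q' ->
  (forall x, graph_of D x -> `|Q x - Q' x| <= e) ->
  forall x, `|T Q x - T Q' x| <= gamma * e.
Proof.
move=> gQ gQ' QQ' x; rewrite !soft_backupE opprD addrACA subrr add0r.
rewrite -mulrBr normrM (ger0_norm gamma0) ler_wpM2l//.
have half Q1 Q2 : admissible K Q1 -> admissible K Q2 ->
    (forall x, graph_of D x -> `|Q1 x - Q2 x| <= e) ->
    \int[p x]_s soft_maximum Q1 s <= \int[p x]_s soft_maximum Q2 s + e.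
  move=> g1 g2 d12; apply: le_Rintegral_prob_kernel.
  - exact: measurable_soft_maximum g1.
  - exact: (fun s => normr_soft_maximum s g1).
  - exact: measurable_soft_maximum g2.
  - exact: (fun s => normr_soft_maximum s g2).
  - move=> s; apply: le_soft_maximum g1 g2 _ => a Da.
    by rewrite -lerBlDl (le_trans (ler_norm _))// d12.
have QQ'C y : graph_of D y -> `|Q' y - Q y| <= e by rewrite distrC; exact: QQ'.
rewrite ler_norml lerBlDl half// andbT -subr_ge0 opprK addrAC subr_ge0.
exact: half.
Qed.

Lemma admissible_iter_soft_backup K Q : rmax + gamma * (K + L) <= K ->
  admissible K Q -> forall l, admissible K (iter l T Q).
Proof.
by move=> stable gQ; elim=> //= l ih; exact: admissible_soft_backup.
Qed.

(** Two members of the ball are at distance at most [K + K], and [l] common backups contract this.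
    The bound does not depend on [m], which gives the Cauchy property. *)
Lemma iter_soft_backup_dist K Q l m : rmax + gamma * (K + L) <= K ->
  admissible K Q -> forall x, graph_of D x ->
  `|iter (l + m) T Q x - iter l T Q x| <= gamma ^+ l * (K + K).
Proof.
move=> stable gQ; have gk := admissible_iter_soft_backup stable gQ.
elim: l => [|l ih] x Dx.
  rewrite add0n expr0 mul1r (le_trans (ler_normB _ _))// lerD//.
    by have [_] := gk m; apply.
  by have [_] := gQ; apply.
rewrite addSn exprS -mulrA; apply: soft_backup_contraction (gk _) (gk _) _ _.
exact: ih.
Qed.

Lemma soft_backup_fixpoint K Q0 : rmax + gamma * (K + L) <= K ->
  admissible K Q0 ->
  exists Qs, [/\ admissible K Qs,
    forall x, graph_of D x -> T Qs x = Qs x &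
    forall l x, graph_of D x ->
      `|iter l T Q0 x - Qs x| <= gamma ^+ l * (K + K)].
Proof.
move=> stable gQ0; have gk := admissible_iter_soft_backup stable gQ0.
have dist := iter_soft_backup_dist _ _ stable gQ0.
have geo : gamma ^+ l * (K + K) @[l --> \oo] --> 0.
  rewrite -[X in _ --> X](mul0r (K + K)); apply: cvgM; last exact: cvg_cst.
  by apply: cvg_expr; rewrite ger0_norm.
have cQ x : graph_of D x -> cvgn (fun l => iter l T Q0 x).
  move=> Dx; apply/cauchy_cvgP/cauchy_exP => e e0.
  have /cvgrPdist_lt/(_ _ e0)[l _ /(_ l (leqnn l)) /= small] := geo.
  exists (iter l T Q0 x); exists l => // n /= ln.
  rewrite /ball /= distrC -(subnKC ln) (le_lt_trans (dist _ _ _ Dx))//.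
  by rewrite (le_lt_trans (ler_norm _))// -normrN -[- _]sub0r.
(* Convergence is known on the graph only; elsewhere this is whatever value [limn] returns. *)
pose Qs x := limn (fun l => iter l T Q0 x).
have QsQ l x : graph_of D x -> `|iter l T Q0 x - Qs x| <= gamma ^+ l * (K + K).
  move=> Dx; rewrite distrC.
  have c : `|iter (m + l) T Q0 x - iter l T Q0 x| @[m --> \oo] -->
      `|Qs x - iter l T Q0 x|.
    apply: cvg_norm; apply: cvgB; last exact: cvg_cst.
    by rewrite (cvg_shiftn l (fun m => iter m T Q0 x)); exact: cQ.
  apply: (cvgr_to_le c); near=> m; rewrite addnC; exact: dist.
have gQs : admissible K Qs.
  split.
  - apply: (@measurable_fun_cvg _ _ _ _ (fun l => iter l T Q0)).
      by move=> l; case: (gk l).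
    by move=> x Dx; exact: cQ.
  - move=> x Dx; apply: (cvgr_to_le (cvg_norm (cQ _ Dx))); near=> m.
    by have [_] := gk m; apply.
exists Qs; split=> // x Dx; apply/eqP; rewrite -subr_eq0 -normr_le0.
(* The triangle inequality through the iterate [l.+1] bounds [|T Qs x - Qs x|] by this vanishing
   sequence: one term from contraction, one from the rate of convergence. *)
have c : gamma ^+ l.+1 * (K + K) + gamma ^+ l.+1 * (K + K) @[l --> \oo] --> 0.
  rewrite -[X in _ --> X](addr0 0); apply: cvgD.
  - by rewrite (cvg_shiftS (fun l => gamma ^+ l * (K + K))).
  - by rewrite (cvg_shiftS (fun l => gamma ^+ l * (K + K))).
apply: (cvgr_to_ge c); near=> l.
rewrite (le_trans (ler_distD (iter l.+1 T Q0 x) _ _))// lerD ?QsQ//.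
rewrite exprS -mulrA distrC; apply: soft_backup_contraction (gk _) gQs _ _.
exact: QsQ.
Unshelve. all: by end_near. Qed.

End soft_maximum.

(** * Policies and the Gibbs variational principle *)

Section policies.
Context {R : realType} {dS dA : measure_display}.
Context {S : measurableType dS} {A : measurableType dA}.
Context {nu : {measure set A -> \bar R}}.
Implicit Types (pi : policy S nu) (s : S).

Lemma measurable_dens_section pi s :
  measurable_fun [set: A] (fun a => dens pi (s, a)).
Proof. exact: measurableT_comp (dens_measurable pi) (pair1_measurable s). Qed.

Lemma ge0_integral_policy pi s (f : A -> \bar R) :
  (forall a, 0 <= f a)%E -> measurable_fun [set: A] f ->
  (\int[pi s]_a f a = \int[nu]_a ((dens pi (s, a))%:E * f a))%E.
Proof.
move=> f0 mf; apply: ge0_integral_density => //.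
- exact: measurable_dens_section.
- by move=> a; exact: dens_ge0.
- by move=> U mU; exact: pol_dens.
Qed.

Lemma measurable_entropy pi : measurable_fun [set: S] (entropy pi).
Proof.
pose f := EFin \o (fun x => - ln (dens pi x)).
have mf : measurable_fun [set: S * A] f.
  apply/measurable_EFinP; apply: measurableT_comp => //.
  exact: measurableT_comp (dens_measurable pi).
(* Measurability of kernel integrals is available for nonnegative integrands, hence the two parts
   are treated separately. *)
rewrite (_ : entropy pi =
    fun s => (\int[pi s]_a f^\+ (s, a) - \int[pi s]_a f^\- (s, a))%E).
  apply: emeasurable_funB.
  - apply: (measurable_fun_integral_finite_kernel (f^\+)%E) => //.
    exact: measurable_funepos.
  - apply: (measurable_fun_integral_finite_kernel (f^\-)%E) => //.
    exact: measurable_funeneg.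
apply/funext => s; rewrite /entropy integralE; congr (_ - _)%E.
- by apply: eq_integral => a _; rewrite !funeposE.
- by apply: eq_integral => a _; rewrite !funenegE.
Qed.

End policies.

(** * The Gibbs variational principle *)

Section gibbs_variational_principle.
Context {R : realType} {dS dA : measure_display}.
Context {S : measurableType dS} {A : measurableType dA}.
Variable nu : {sigma_finite_measure set A -> \bar R}.
Variable D : S -> set A.
Hypothesis mD : measurable (graph_of D).
Variables lo hi : R.
Hypothesis lo0 : 0 < lo.
Hypothesis volD : forall s, (lo%:E <= nu (D s))%E /\ (nu (D s) <= hi%:E)%E.
Variables (Q : S * A -> R) (K : R).
Hypothesis mQ : measurable_fun [set: S * A] Q.
Hypothesis QK : forall x, `|Q x| <= K.

Let V := soft_maximum nu D Q.

Let gQ : admissible D K Q.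
Proof. by split=> [|x _]; [exact: measurable_funTS|exact: QK]. Qed.

Let expRV s :
  ((expR (V s))%:E = \int[nu]_(a in D s) (expR (Q (s, a)))%:E)%E.
Proof. exact (expR_soft_maximum mD lo0 volD s gQ). Qed.

Let mQs s : measurable_fun [set: A] (fun a => Q (s, a)).
Proof. exact: measurableT_comp mQ (pair1_measurable s). Qed.

Let mDs s : measurable (D s). Proof. exact: measurable_section. Qed.

Let integral_softmax s :
  (\int[nu]_(a in D s) (expR (Q (s, a) - V s))%:E = 1)%E.
Proof.
under eq_integral do rewrite expRD mulrC EFinM.
rewrite ge0_integralZl//; last first.
  by apply/measurable_EFinP; apply: measurable_funTS; exact: measurableT_comp.
by rewrite -expRV -EFinM -expRD addNr expR0.
Qed.

Section upper_bound.
Variables (pi : policy S nu) (s : S).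
Hypothesis pi_arbiter : arbiter D pi.

Let d a := dens pi (s, a).

Let h a := Q (s, a) - ln (d a) - V s.

Let mh : measurable_fun [set: A] h.
Proof.
apply: measurable_funB => //; apply: measurable_funB => //.
by apply: measurableT_comp => //; exact: measurable_dens_section.
Qed.

(** Times the density of [pi], [expR h] becomes the softmax density where the former is positive and
    [0] elsewhere. Only an inequality results, as [pi] may leave part of [D s] uncharged. *)
Let integral_expRh : (\int[pi s]_a (expR (h a))%:E <= 1)%E.
Proof.
have mexph : measurable_fun [set: A] (EFin \o (expR \o h)).
  by apply/measurable_EFinP; exact: measurableT_comp.
rewrite (@ge0_negligible_integral _ _ _ _ _ (~` D s))//; last first.
  exact: measurableC.
rewrite setDE setCK setTI integral_mkcond ge0_integral_policy; last 2 first.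
- by move=> a; rewrite patchE; case: ifPn => // _; rewrite lee_fin expR_ge0.
- by apply/(measurable_restrictT _ (mDs s)); exact: measurable_funTS.
rewrite -(integral_softmax s) [leRHS]integral_mkcond.
apply: ge0_le_integral => //.
- move=> a _; rewrite mule_ge0 ?lee_fin ?dens_ge0// patchE.
  by case: ifPn => // _; rewrite lee_fin expR_ge0.
- apply: emeasurable_funM; last first.
    by apply/(measurable_restrictT _ (mDs s)); exact: measurable_funTS.
  by apply/measurable_EFinP; exact: measurable_dens_section.
- apply/(measurable_restrictT _ (mDs s)); apply: measurable_funTS.
  apply/measurable_EFinP; apply: measurableT_comp => //.
  exact: measurable_funB.
- move=> a _; rewrite !patchE; case: ifPn => _; last by rewrite mule0.
  (* At zeros of the density the value of [ln] is immaterial: the product is [0]. *)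
  rewrite -EFinM lee_fin -/(d a); have : 0 <= d a by exact: dens_ge0.
  rewrite le_eqVlt => /predU1P[<-|d0]; first by rewrite mul0r expR_ge0.
  have -> : h a = Q (s, a) - V s - ln (d a) by rewrite /h addrAC.
  rewrite (expRD (Q (s, a) - V s)) (expRN (ln (d a))) (@lnK R (d a)) ?posrE//.
  by rewrite mulrCA divff ?mulr1// gt_eqF.
Qed.

(* Jensen's inequality, in the form [x + 1 <= expR x] for the log-density
   [x = h a] of the softmax policy with respect to [pi]. *)
Lemma gibbs_inequality :
  (entropy pi s <= (V s - \int[pi s]_a Q (s, a))%:E)%E.
Proof.
have iQ : (pi s).-integrable [set: A] (EFin \o (fun a => Q (s, a))).
  exact: integrable_prob_kernel (fun a => QK (s, a)).
have iV : (pi s).-integrable [set: A] (EFin \o cst (V s - 1)).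
  exact: (@integrable_prob_kernel _ _ _ _ _ _ _ `|V s - 1|).
have mexph : measurable_fun [set: A] (EFin \o (expR \o h)).
  by apply/measurable_EFinP; exact: measurableT_comp.
have ih : (pi s).-integrable [set: A] (EFin \o (expR \o h)).
  apply/integrableP; split=> //=.
  under eq_integral do rewrite ger0_norm ?expR_ge0//.
  by rewrite (le_lt_trans integral_expRh)// ltry.
have iVQ : (pi s).-integrable [set: A]
    (fun a => (cst (V s - 1) a)%:E - (Q (s, a))%:E)%E.
  exact: integrableB.
apply: (@le_trans _ _
    (\int[pi s]_a
      ((expR (h a))%:E + ((cst (V s - 1) a)%:E - (Q (s, a))%:E)))%E).
  apply: le_integral_measurable.
  - apply/measurable_EFinP; apply: measurableT_comp => //.
    by apply: measurableT_comp => //; exact: measurable_dens_section.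
  - by case/integrableP: (integrableD measurableT ih iVQ).
  - move=> a; rewrite lee_fin -lerBlDr; apply: le_trans (expR_ge1Dx _).
    by rewrite /h /d /=; lra.
rewrite integralD// integralB//.
rewrite -(EFin_Rintegral_prob_kernel pi s (mQs s) (fun a => QK (s, a))).
rewrite (integral_cst (pi s) measurableT (V s - 1)%:E) prob_kernel mule1.
rewrite -EFinB.
apply: (@le_trans _ _ (1 + (V s - 1 - \int[pi s]_a Q (s, a))%:E)%E).
  by rewrite leeD.
by rewrite -EFinD lee_fin; lra.
Qed.

End upper_bound.

(** * The softmax policy, where equality holds *)

Definition softmax_density : S * A -> R :=
  (fun x => expR (Q x - V x.1)) \_ (graph_of D).

Lemma softmax_density_ge0 x : 0 <= softmax_density x.
Proof. by rewrite /softmax_density patchE; case: ifPn. Qed.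

Lemma measurable_softmax_density : measurable_fun [set: S * A] softmax_density.
Proof.
apply/(measurable_restrictT _ mD); apply: measurable_funTS.
apply: measurableT_comp => //; apply: measurable_funB => //.
apply: measurableT_comp => //; exact: measurable_soft_maximum gQ.
Qed.

Let softmax_densityE s a :
  softmax_density (s, a) = ((fun a => expR (Q (s, a) - V s)) \_ (D s)) a.
Proof.
rewrite /softmax_density !patchE.
by rewrite mem_graph_of.
Qed.

Definition softmax_measure s (B : set A) : \bar R :=
  (\int[nu]_(a in B) (softmax_density (s, a))%:E)%E.

Let softmax_measure0 s : softmax_measure s set0 = 0%E.
Proof. by rewrite /softmax_measure integral_set0. Qed.

Let softmax_measure_ge0 s B : (0 <= softmax_measure s B)%E.
Proof. by apply: integral_ge0 => a _; rewrite lee_fin softmax_density_ge0. Qed.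

Let softmax_measure_sigma_additive s : semi_sigma_additive (softmax_measure s).
Proof.
apply: semi_sigma_additive_nng_induced.
- apply/measurable_EFinP.
  exact: measurableT_comp measurable_softmax_density (pair1_measurable s).
- by move=> a; rewrite lee_fin softmax_density_ge0.
Qed.

HB.instance Definition _ s := isMeasure.Build _ _ _ (softmax_measure s)
  (softmax_measure0 s) (softmax_measure_ge0 s)
  (@softmax_measure_sigma_additive s).

Definition softmax_kernel : S -> {measure set A -> \bar R} := softmax_measure.

Let measurable_softmax_kernel U : measurable U ->
  measurable_fun [set: S] (softmax_kernel ^~ U).
Proof.
move=> mU; pose f x := ((softmax_density x * \1_U x.2)%:E)%E.
rewrite (_ : softmax_kernel ^~ U = fubini_F nu f).
  apply: measurable_fun_fubini_tonelli_F.
  - apply/measurable_EFinP; apply: measurable_funM.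
      exact: measurable_softmax_density.
    by apply: measurableT_comp => //; exact: measurable_indic.
  - by move=> x; rewrite lee_fin mulr_ge0// softmax_density_ge0.
apply/funext => s.
transitivity (\int[nu]_(a in U) (softmax_density (s, a))%:E)%E => //.
rewrite /fubini_F [LHS]integral_mkcond; apply: eq_integral => a _.
rewrite patchE /f /= indicE.
by case: ifPn => _; rewrite ?mulr1 ?mulr0.
Qed.

HB.instance Definition _ := isKernel.Build _ _ _ _ _ softmax_kernel
  measurable_softmax_kernel.

Let softmax_kernel_setT s : softmax_kernel s [set: A] = 1%E.
Proof.
rewrite -(integral_softmax s) [RHS]integral_mkcond.
by apply: eq_integral => a _; rewrite softmax_densityE restrict_EFin.
Qed.

HB.instance Definition _ := Kernel_isProbability.Build _ _ _ _ _ softmax_kernel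
  softmax_kernel_setT.

Definition softmax_policy : policy S nu := Policy measurable_softmax_density
  softmax_density_ge0 (pol := softmax_kernel) (fun s B _ => erefl).

Lemma arbiter_softmax_policy : arbiter D softmax_policy.
Proof.
move=> s; apply: integral0_eq => a nDa.
by rewrite softmax_densityE patchE memNset.
Qed.

(** On [D s] minus the log-density is exactly [V - Q]; off [D s], where the density is [0] and this
    fails, the policy has no mass. *)
Lemma entropy_softmax_policy s :
  (entropy softmax_policy s = (V s - \int[softmax_policy s]_a Q (s, a))%:E)%E.
Proof.
pose P : R.-pker S ~> A := softmax_policy.
have iQ : (P s).-integrable [set: A] (EFin \o (fun a => Q (s, a))).
  exact: integrable_prob_kernel (fun a => QK (s, a)).
have iV : (P s).-integrable [set: A] (EFin \o cst (V s)).
  exact: (@integrable_prob_kernel _ _ _ _ _ _ _ `|V s|).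
transitivity (\int[P s]_a (((cst (V s)) a)%:E - (Q (s, a))%:E))%E.
  apply: ae_eq_integral => //.
  - apply/measurable_EFinP; apply: measurableT_comp => //.
    by apply: measurableT_comp => //; exact: measurable_dens_section.
  - by case/integrableP: (integrableB measurableT iV iQ).
  - exists (~` D s); split; [exact: measurableC|exact: arbiter_softmax_policy|].
    move=> a /= /not_implyP[_]; apply: contra_not => Da.
    by rewrite softmax_densityE patchE mem_set// expRK opprB EFinB.
rewrite integralB// EFinB.
rewrite (EFin_Rintegral_prob_kernel P s (mQs s) (fun a => QK (s, a))).
by rewrite (integral_cst (P s) measurableT (V s)%:E) prob_kernel mule1.
Qed.

End gibbs_variational_principle.

(** * The state-action chain and its discounted costs *)

Section state_action_chain.
Local Open Scope ereal_scope.
Context {R : realType} {dS dA : measure_display}.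
Context {S : measurableType dS} {A : measurableType dA}.
Context {nu : {measure set A -> \bar R}}.
Variables (p : R.-pker (S * A) ~> S) (pi : policy S nu).
Implicit Types (f g : S * A -> \bar R).

(** The transition operator of the chain acting on functions. Its iterates move the dynamics from
    the laws onto the integrand, the form suited to Bellman recursions. *)
Definition chain_op f (y : S * A) : \bar R :=
  \int[p y]_s \int[draw pi s]_x f x.

Lemma ge0_integral_draw s f : (forall x, 0 <= f x) ->
  measurable_fun [set: S * A] f ->
  \int[draw pi s]_x f x = \int[pi s]_a f (s, a).
Proof.
move=> f0 mf.
rewrite (@ge0_integral_mixture _ _ _ _ _ (draw pi s) (pi s)
  (fun a => kid (s, a)))//.
  by apply: eq_integral => a _; rewrite integral_dirac// diracT mul1e.
move=> U mU; have := measurable_kernel (@kid R dS dA S A) U mU.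
by move=> /measurableT_comp; apply.
Qed.

Lemma measurable_integral_draw f : (forall x, 0 <= f x) ->
  measurable_fun [set: S * A] f ->
  measurable_fun [set: S] (fun s => \int[draw pi s]_x f x).
Proof.
move=> f0 mf; apply: measurable_fun_integral_kernel => // U mU.
exact: measurable_kernel.
Qed.

Lemma draw_support (D : S -> set A) s : measurable (graph_of D) ->
  arbiter D pi -> draw pi s (~` graph_of D) = 0.
Proof.
move=> mD pi_arbiter; transitivity (pi s (~` D s)); last exact: pi_arbiter.
transitivity (\int[pi s]_a (\1_(~` D s) a)%:E).
  apply: eq_integral => a _; rewrite /kid/= /kdirac /dirac/= !indicE.
  by congr (_%:R%:E); apply/idP/idP; rewrite !inE.
rewrite integral_indic// ?setIT//; apply: measurableC.
exact: measurable_section.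
Qed.

Lemma chain_op_ge0 f : (forall x, 0 <= f x) -> forall x, 0 <= chain_op f x.
Proof. by move=> f0 x; apply: integral_ge0 => s _; apply: integral_ge0. Qed.

Lemma measurable_chain_op f : (forall x, 0 <= f x) ->
  measurable_fun [set: S * A] f -> measurable_fun [set: S * A] (chain_op f).
Proof.
move=> f0 mf; apply: measurable_fun_integral_kernel.
- by move=> U mU; exact: measurable_kernel.
- by move=> s; apply: integral_ge0.
- exact: measurable_integral_draw.
Qed.

Lemma iter_chain_op_ge0 t f : (forall x, 0 <= f x) ->
  forall x, 0 <= iter t chain_op f x.
Proof. by move=> f0; elim: t => //= t ih; exact: chain_op_ge0. Qed.

Lemma measurable_iter_chain_op t f : (forall x, 0 <= f x) ->
  measurable_fun [set: S * A] f ->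
  measurable_fun [set: S * A] (iter t chain_op f).
Proof.
move=> f0 mf; elim: t => //= t ih; apply: measurable_chain_op => //.
exact: iter_chain_op_ge0.
Qed.

Lemma ge0_integral_sa_step y f : (forall x, 0 <= f x) ->
  measurable_fun [set: S * A] f -> \int[sa_step p pi y]_x f x = chain_op f y.
Proof.
move=> f0 mf; rewrite (@ge0_integral_mixture _ _ _ _ _ _ (p y) (draw pi))//.
by move=> U mU; exact: measurable_kernel.
Qed.

Section marginals.
Context {dX : measure_display} {X : measurableType dX}.
Variables (init : R.-spker X ~> (S * A)%type) (x : X).

(** Duality between laws and functions: the last step of the chain is peeled off the law and becomes
    one application of [chain_op] to [f]. *)
Lemma ge0_integral_sa_marginal t f : (forall x, 0 <= f x) ->
  measurable_fun [set: S * A] f ->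
  \int[sa_marginal p pi init t x]_y f y = \int[init x]_y iter t chain_op f y.
Proof.
elim: t f => [//|t ih] f f0 mf.
rewrite (@ge0_integral_mixture _ _ _ _ _ _ (sa_marginal p pi init t x)
  (sa_step p pi))//; last by move=> U mU; exact: measurable_kernel.
under eq_integral do rewrite ge0_integral_sa_step//.
rewrite ih; [|exact: chain_op_ge0|exact: measurable_chain_op].
by under eq_integral do rewrite -iterSr.
Qed.

Lemma sa_marginal_setT t : init x [set: S * A] = 1 ->
  sa_marginal p pi init t x [set: S * A] = 1.
Proof.
move=> init1; elim: t => [//|t ih].
transitivity (\int[sa_marginal p pi init t x]_y cst 1 y).
  apply: eq_integral => y _; transitivity (\int[p y]_s cst 1 s).
    by apply: eq_integral => s _; exact: draw_setT.
  by rewrite integral_cst// prob_kernel mule1.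
by rewrite integral_cst// ih mule1.
Qed.

(** At time [0] this is the assumption on [init]; at later times the action has just been drawn from
    an arbiter policy. *)
Lemma sa_marginal_support (D : S -> set A) t : measurable (graph_of D) ->
  arbiter D pi -> init x (~` graph_of D) = 0 ->
  sa_marginal p pi init t x (~` graph_of D) = 0.
Proof.
move=> mD pi_arbiter init0; case: t => [//|t].
apply: integral0_eq => y _; apply: integral0_eq => s _.
exact: draw_support.
Qed.

End marginals.

End state_action_chain.

(** * Discounted costs of a fixed arbiter policy and their Bellman recursion *)

Section soft_cost.
Local Open Scope ereal_scope.
Context {R : realType} {dS dA : measure_display}.
Context {S : measurableType dS} {A : measurableType dA}.
Context {nu : {measure set A -> \bar R}}.
Variables (p : R.-pker (S * A) ~> S) (pi : policy S nu).
Variable D : S -> set A.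
Hypothesis mD : measurable (graph_of D).
Hypothesis pi_arbiter : arbiter D pi.
Variables (gamma : R) (r : S * A -> R) (B : R).
Hypothesis gamma01 : (0 <= gamma < 1)%R.
Hypothesis mr : measurable_fun [set: S * A] r.

Let gamma0 : (0 <= gamma)%R. Proof. by case/andP: gamma01. Qed.
Let gamma_ge0 t : 0 <= (gamma ^+ t)%:E.
Proof. by rewrite lee_fin exprn_ge0. Qed.

(* Subtracting the reward from an upper bound [B] turns all the series and
   iterated integrals below into series and integrals of nonnegative terms,
   although the entropy may be [-oo]. *)
Definition soft_cost (x : S * A) : \bar R :=
  B%:E - (((r \_ (graph_of D)) x)%:E + entropy pi x.1).

Hypothesis cost_ge0 : forall x, 0 <= soft_cost x.

Let mrD : measurable_fun [set: S * A] (r \_ (graph_of D)).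
Proof. by apply/(measurable_restrictT _ mD); exact: measurable_funTS. Qed.

Let mH : measurable_fun [set: S * A] (fun x => entropy pi x.1).
Proof. exact: measurableT_comp (measurable_entropy pi) measurable_fst. Qed.

Let mrH : measurable_fun [set: S * A]
  (fun x => ((r \_ (graph_of D)) x)%:E + entropy pi x.1).
Proof. by apply: emeasurable_funD => //; exact/measurable_EFinP. Qed.

Lemma measurable_soft_cost : measurable_fun [set: S * A] soft_cost.
Proof. exact: emeasurable_funB. Qed.

Let Pc t := iter t (chain_op p pi) soft_cost.

Let Pc0 t x : 0 <= Pc t x. Proof. exact: iter_chain_op_ge0. Qed.

Let mPc t : measurable_fun [set: S * A] (Pc t).
Proof.
by apply: measurable_iter_chain_op => //; exact: measurable_soft_cost.
Qed.

(** The marginal does not charge the complement of the graph, so the reward may be set to [0] there.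
    The integrand is then at most [gamma ^+ t * B], and the deficit from this bound is the expected
    cost. *)
Lemma integral_soft_reward (dX : measure_display) (X : measurableType dX)
    (init : R.-spker X ~> (S * A)%type) (x : X) t :
  init x [set: S * A] = 1 -> init x (~` graph_of D) = 0 ->
  \int[sa_marginal p pi init t x]_y soft_reward r gamma pi t y =
  (gamma ^+ t)%:E * (B%:E - \int[init x]_y Pc t y).
Proof.
move=> init1 init0; set mu := sa_marginal p pi init t x.
have mu1 : mu [set: S * A] = 1 by exact: sa_marginal_setT.
have mu0 : mu (~` graph_of D) = 0 by exact: sa_marginal_support.
pose f y := (gamma ^+ t)%:E * (((r \_ (graph_of D)) y)%:E + entropy pi y.1).
have mf : measurable_fun [set: S * A] f by exact: measurable_funeM.
transitivity (\int[mu]_y f y).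
  apply: ae_eq_integral => //.
  - apply: measurable_funeM; apply: emeasurable_funD => //.
    exact/measurable_EFinP.
  - exists (~` graph_of D); split=> //; first exact: measurableC.
    move=> y /= /not_implyP[_]; apply: contra_not => Dy.
    by rewrite /f /soft_reward patchE mem_set.
have fB y : f y <= (gamma ^+ t * B)%:E.
  rewrite /f EFinM lee_wpmul2l//.
  by have := cost_ge0 y; rewrite /soft_cost sube_ge0 ?orbT.
rewrite (integral_bounded_above mu1 mf fB) muleBr ?fin_num_adde_defr// -EFinM.
congr (_ - _).
rewrite -ge0_integral_sa_marginal//; last exact: measurable_soft_cost.
rewrite -ge0_integralZl//; last exact: measurable_soft_cost.
apply: eq_integral => y _.
by rewrite /f /soft_cost [RHS]muleBr ?fin_num_adde_defr// -EFinM.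
Qed.

Definition total_cost s : \bar R :=
  \sum_(0 <= t <oo) (gamma ^+ t)%:E * \int[draw pi s]_x Pc t x.

Lemma objectiveE s :
  objective p r gamma pi s = (B / (1 - gamma))%:E - total_cost s.
Proof.
rewrite /objective.
under eq_eseriesr => t _.
  rewrite integral_soft_reward; [over|exact: draw_setT|exact: draw_support].
by rewrite discounted_sumB// ?expr0 ?mul1r// => t; exact: integral_ge0.
Qed.

Let I t s := \int[draw pi s]_x Pc t x.

Let I0 t s : 0 <= I t s. Proof. exact: integral_ge0. Qed.

Let mI t : measurable_fun [set: S] (I t).
Proof. exact: measurable_integral_draw. Qed.

Let gI0 t s : 0 <= (gamma ^+ t)%:E * I t s. Proof. exact: mule_ge0. Qed.

Let mgI t : measurable_fun [set: S] (fun s => (gamma ^+ t)%:E * I t s).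
Proof. exact: measurable_funeM. Qed.

(** The expected cost at time [t.+1] from [x] is the average over the next state of the cost at time
    [t]. One factor [gamma] comes out, and nonnegativity allows exchanging sum and integral. *)
Lemma soft_valueE x : graph_of D x ->
  soft_value p r gamma pi x =
  (r x + gamma * B / (1 - gamma))%:E -
    gamma%:E * \int[p x]_s total_cost s.
Proof.
move=> Dx; have kid0 : @kid R dS dA S A x (~` graph_of D) = 0.
  rewrite [LHS](_ : _ = (\1_(~` graph_of D) x)%:E)// indicE memNset//.
rewrite /soft_value; under eq_eseriesr => l _.
  rewrite integral_soft_reward//; last exact: prob_kernel.
  rewrite integral_dirac// diracT mul1e.
  over.
rewrite discounted_sumB// expr1 addeA -EFinD; congr (_ - _).
rewrite /total_cost integral_nneseries//; last by move=> t s _; exact: gI0.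
rewrite -nneseriesZl; last first.
  by move=> t _; apply: integral_ge0 => s _; exact: gI0.
rewrite nneseries_shift1; last by move=> l; exact: mule_ge0.
apply: eq_eseriesr => t _; rewrite exprS EFinM -muleA; congr (_ * _).
by rewrite (ge0_integralZl _ measurableT (mI t)).
Qed.

Let partial_cost N s := \sum_(0 <= t < N) (gamma ^+ t)%:E * I t s.

Let partial_cost_ge0 N s : 0 <= partial_cost N s.
Proof. by apply: sume_ge0 => t _. Qed.

Let measurable_partial_cost N : measurable_fun [set: S] (partial_cost N).
Proof. exact: emeasurable_sum. Qed.

(** The policy-evaluation operator: expected immediate cost plus discounted cost-to-go. *)
Definition cost_bellman (W : S -> \bar R) s : \bar R :=
  \int[draw pi s]_x (soft_cost x + gamma%:E * \int[p x]_s' W s').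

Let gW0 (W : S -> \bar R) : (forall s, 0 <= W s) ->
  forall x, 0 <= gamma%:E * \int[p x]_s W s.
Proof. by move=> W0 x; rewrite mule_ge0 ?lee_fin ?integral_ge0. Qed.

Let mgW (W : S -> \bar R) : (forall s, 0 <= W s) ->
  measurable_fun [set: S] W ->
  measurable_fun [set: S * A] (fun x => gamma%:E * \int[p x]_s W s).
Proof.
move=> W0 mW; apply: measurable_funeM.
apply: measurable_fun_integral_kernel => //.
exact: measurable_kernel.
Qed.

(** Finite-horizon costs are thus the iterates of [cost_bellman] started from [0]. *)
Let partial_costS N s : partial_cost N.+1 s = cost_bellman (partial_cost N) s.
Proof.
rewrite /cost_bellman ge0_integralD//; last 3 first.
- exact: measurable_soft_cost.
- by move=> x _; exact: gW0.
- exact: mgW.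
rewrite /partial_cost big_nat_recl// expr0 mul1e; congr (_ + _).
under [RHS]eq_integral => x _.
  rewrite ge0_integral_sum// ge0_sume_distrr; last first.
    by move=> t _; exact: integral_ge0.
  under eq_bigr => t _ do rewrite ge0_integralZl// muleA -EFinM -exprS.
  over.
rewrite ge0_integral_sum//.
- by apply: eq_bigr => t _; rewrite (ge0_integralZl _ measurableT (mPc t.+1)).
- by move=> t; apply: measurable_funeM; exact: mPc t.+1.
- by move=> t x _; rewrite mule_ge0//; exact: Pc0 t.+1 x.
Qed.

Let le_bellman (W W' : S -> \bar R) : (forall s, 0 <= W s) ->
  measurable_fun [set: S] W -> measurable_fun [set: S] W' ->
  (forall s, W s <= W' s) -> forall s, cost_bellman W s <= cost_bellman W' s.
Proof.
move=> W0 mW mW' WW' s; have W'0 s' : 0 <= W' s' by rewrite (le_trans (W0 s')).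
have mc := measurable_soft_cost.
apply: ge0_le_integral => //.
- by move=> x _; rewrite adde_ge0// gW0.
- by apply: emeasurable_funD => //; exact: mgW.
- by apply: emeasurable_funD => //; exact: mgW.
- by move=> x _; rewrite leeD2l// lee_wpmul2l ?lee_fin// ge0_le_integral.
Qed.

(** By monotonicity a nonnegative supersolution dominates every iterate from [0], hence their
    limit. *)
Lemma total_cost_le (W : S -> \bar R) : (forall s, 0 <= W s) ->
  measurable_fun [set: S] W ->
  (forall s, cost_bellman W s <= W s) -> forall s, total_cost s <= W s.
Proof.
move=> W0 mW super.
have le N : forall s, partial_cost N s <= W s.
  elim: N => [|N ih] s; first by rewrite /partial_cost big_geq.
  by rewrite partial_costS (le_trans _ (super s))// le_bellman.
move=> s; apply: lime_le; last by apply: nearW => N; exact: le.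
by apply: is_cvg_nneseries => t _ _; exact: gI0.
Qed.

(** A subsolution bounded by [w] exceeds the cost over horizon [N] by at most [gamma ^+ N * w],
    since each step discounts a constant excess once more; the excess vanishes in the limit. *)
Lemma total_cost_ge (W : S -> \bar R) (w : R) : (forall s, 0 <= W s) ->
  (forall s, W s <= w%:E) -> measurable_fun [set: S] W ->
  (forall s, W s <= cost_bellman W s) -> forall s, W s <= total_cost s.
Proof.
move=> W0 Ww mW sub s0.
have w0 : (0 <= w)%R by rewrite -lee_fin (le_trans (W0 s0)).
have le N : forall s, W s <= partial_cost N s + (gamma ^+ N * w)%:E.
  elim: N => [|N ih] s.
    by rewrite /partial_cost big_geq// expr0 mul1r add0e.
  have gw0 : 0 <= (gamma ^+ N * w)%:E by rewrite lee_fin mulr_ge0 ?exprn_ge0.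
  apply: (le_trans (sub s)); apply: (@le_trans _ _
      (cost_bellman (fun s => partial_cost N s + (gamma ^+ N * w)%:E) s)).
    apply: le_bellman => //; exact: emeasurable_funD.
  rewrite partial_costS /cost_bellman exprS -mulrA [(gamma * _)%:E]EFinM.
  under [leLHS]eq_integral => x _.
    rewrite ge0_integralD// (integral_cst (p x) measurableT) prob_kernel mule1.
    rewrite ge0_muleDr ?integral_ge0// addeA.
    over.
  rewrite ge0_integralD//; last 3 first.
  - by move=> x _; rewrite adde_ge0// gW0.
  - by apply: emeasurable_funD; [exact: measurable_soft_cost|exact: mgW].
  - by move=> x _; rewrite mule_ge0 ?lee_fin.
  rewrite leeD2l//.
  rewrite (integral_cst _ measurableT (gamma%:E * (gamma ^+ N * w)%:E)).
  by rewrite draw_setT mule1.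
have c : partial_cost N s0 + (gamma ^+ N * w)%:E @[N --> \oo] -->
    total_cost s0 + (0 * w)%:E.
  apply: cvgeD; first by rewrite fin_num_adde_defl.
    by apply: is_cvg_nneseries => t _ _; exact: gI0.
  apply: cvg_EFin; first by near=> N.
  apply: cvgM; last exact: cvg_cst.
  by apply: cvg_expr; rewrite ger0_norm//; case/andP: gamma01.
have <- : total_cost s0 + (0 * w)%:E = total_cost s0 by rewrite mul0r adde0.
by apply: (cvge_to_ge c); near=> N.
Unshelve. all: by end_near. Qed.

End soft_cost.

(** * Optimal arbiter policies *)

Section optimal_policy.
Context {R : realType} {dS dA : measure_display}.
Context {S : measurableType dS} {A : measurableType dA}.
Variable nu : {sigma_finite_measure set A -> \bar R}.
Variable D : S -> set A.
Hypothesis mD : measurable (graph_of D).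
Variables lo hi : R.
Hypothesis lo0 : 0 < lo.
Hypothesis volD : forall s, (lo%:E <= nu (D s))%E /\ (nu (D s) <= hi%:E)%E.
Variables (p : R.-pker (S * A) ~> S) (gamma : R) (r : S * A -> R).
Variables (rmax K : R).
Hypothesis gamma01 : 0 <= gamma < 1.
Hypothesis mr : measurable_fun [set: S * A] r.
Hypothesis rmax0 : 0 <= rmax.
Hypothesis rb : forall x, graph_of D x -> `|r x| <= rmax.

Let L := log_volume_bound lo hi.

Hypothesis stable : rmax + gamma * (K + L) <= K.

Variable Qs : S * A -> R.
Hypothesis gQs : admissible D K Qs.
Hypothesis fixQs : forall x, graph_of D x ->
  soft_backup nu p r gamma D Qs x = Qs x.

Let V := soft_maximum nu D Qs.
(** Serves twice: it bounds [|V|], and it bounds reward plus entropy, because [stable] gives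
    [rmax <= K] and entropies are at most [L]. *)
Let B := K + L.
Let B' := B / (1 - gamma).

Let gamma0 : 0 <= gamma. Proof. by case/andP: gamma01. Qed.
Let gamma1 : 0 < 1 - gamma. Proof. by rewrite subr_gt0; case/andP: gamma01. Qed.

Let mV : measurable_fun [set: S] V.
Proof. exact: measurable_soft_maximum gQs. Qed.

Let VB s : `|V s| <= B.
Proof. exact: (normr_soft_maximum mD lo0 volD). Qed.

Let B'E : B + gamma * B' = B'.
Proof. by rewrite /B'; field; rewrite gt_eqF. Qed.

(* The soft Q-function [Qs] extended to a measurable bounded function on all
   pairs, the reward being set to [0] off the graph of [D]. *)
Let Qt (x : S * A) := (r \_ (graph_of D)) x + gamma * \int[p x]_s V s.

Let rDmax x : `|(r \_ (graph_of D)) x| <= rmax.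
Proof.
rewrite patchE; case: ifPn => [|_]; last by rewrite normr0.
by rewrite inE; exact: rb.
Qed.

Let QtE x : graph_of D x -> Qt x = Qs x.
Proof. by move=> Dx; rewrite /Qt patchE mem_set// -fixQs. Qed.

Let mQt : measurable_fun [set: S * A] Qt.
Proof.
apply: measurable_funD.
  by apply/(measurable_restrictT _ mD); exact: measurable_funTS.
apply: measurable_funM => //; exact: measurable_Rintegral_prob_kernel VB.
Qed.

Let QtK x : `|Qt x| <= K.
Proof.
apply: le_trans stable; rewrite (le_trans (ler_normD _ _))// lerD//.
rewrite normrM ger0_norm// ler_wpM2l//.
exact: normr_Rintegral_prob_kernel.
Qed.

Let mQts s : measurable_fun [set: A] (fun a => Qt (s, a)).
Proof. exact: measurableT_comp mQt (pair1_measurable s). Qed.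

Let soft_maximum_Qt s : soft_maximum nu D Qt s = V s.
Proof.
congr ln; apply: eq_Rintegral => a; rewrite inE => Da.
by rewrite QtE.
Qed.

(** The value [V] read as a cost: [B'] is the discounted total of the constant reward [B]. *)
Let W s : \bar R := (B' - V s)%:E.

(** The argument [s] witnesses that there is a state at all; the sign of [B] is read off the bound
    on [|V s|]. *)
Let B0 (s : S) : 0 <= B. Proof. exact: le_trans (VB s). Qed.

Let BB' (s : S) : B <= B'.
Proof.
rewrite -[leRHS]B'E lerDl mulr_ge0// divr_ge0//; first exact: B0.
exact: ltW.
Qed.

Let W0 s : (0 <= W s)%E.
Proof.
rewrite lee_fin subr_ge0 (le_trans _ (BB' s))//.
by rewrite (le_trans (ler_norm _)).
Qed.

Let Ww s : (W s <= (B' + B)%:E)%E.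
Proof.
rewrite lee_fin lerD2l (le_trans (ler_norm _))// normrN.
exact: VB.
Qed.

Let mW : measurable_fun [set: S] W.
Proof. by apply/measurable_EFinP; exact: measurable_funB. Qed.

Let integral_W x : (\int[p x]_s W s = (B' - \int[p x]_s V s)%:E)%E.
Proof.
rewrite -(@EFin_Rintegral_prob_kernel _ _ _ _ _ p (fun s => B' - V s) (B' + B)).
- rewrite RintegralB ?Rintegral_prob_kernel_cst//.
  + exact: (@integrable_prob_kernel _ _ _ _ _ _ _ `|B'|).
  + exact: integrable_prob_kernel VB.
- exact: measurable_funB.
- move=> s; rewrite (le_trans (ler_normB _ _))// lerD//.
  by rewrite ger0_norm// (le_trans (B0 s))// BB'.
Qed.

(** * Upper bound for every arbiter policy *)

Section arbiter_policy.
Variable pi : policy S nu.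
Hypothesis pi_arbiter : arbiter D pi.

(** Gibbs' inequality for the zero function, whose soft maximum is the logarithm of the volume of
    [D s]. *)
Lemma entropy_le_log_volume s : (entropy pi s <= L%:E)%E.
Proof.
have m0 : measurable_fun [set: S * A] (cst 0 : S * A -> R) by [].
have b0 x : `|(cst 0 : S * A -> R) x| <= 0 by rewrite normr0.
rewrite (le_trans (gibbs_inequality mD lo0 volD m0 b0 s pi_arbiter))// lee_fin.
rewrite Rintegral_prob_kernel_cst subr0 (le_trans (ler_norm _))//.
rewrite -[leRHS]add0r; apply: (normr_soft_maximum mD lo0 volD).
by split=> [|x _]; [exact: measurable_funTS|exact: b0].
Qed.

Lemma soft_cost_ge0 x : (0 <= soft_cost pi D r B x)%E.
Proof.
rewrite /soft_cost sube_ge0 ?orbT// EFinD leeD ?entropy_le_log_volume// lee_fin.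
rewrite (le_trans (ler_norm _))// (le_trans (rDmax _))//.
apply: le_trans stable; rewrite lerDl mulr_ge0//; exact: B0 x.1.
Qed.

(** Since [B + gamma * B' = B'], cost plus discounted [W] collapses to [B' - Qt] minus the
    entropy. *)
Lemma cost_bellmanE s : cost_bellman p pi D gamma r B W s =
  ((B' - \int[pi s]_a Qt (s, a))%:E - entropy pi s)%E.
Proof.
have costE x : (soft_cost pi D r B x + gamma%:E * \int[p x]_s W s =
    (B' - Qt x)%:E - entropy pi x.1)%E.
  rewrite integral_W.
  rewrite /soft_cost -EFinM.
  have : (entropy pi x.1 < +oo)%E.
    by rewrite (le_lt_trans (entropy_le_log_volume _))// ltry.
  case: (entropy pi x.1) => [h _||]//=.
  rewrite -!EFinD; congr (_%:E).
  by rewrite /Qt -[X in _ = X - _ - _]B'E; ring.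
have h_lty : (entropy pi s < +oo)%E.
  by rewrite (le_lt_trans (entropy_le_log_volume _))// ltry.
rewrite /cost_bellman; under eq_integral do rewrite costE.
rewrite ge0_integral_draw.
(* The entropy is constant in the action: if finite, linearity applies; if [-oo], both sides are
   [+oo]. *)
- move: h_lty => /=; case: (entropy pi s) => [h _||_]//=.
  + have iQ := integrable_prob_kernel pi s (mQts s) (fun a => QtK (s, a)).
    have ic : (pi s).-integrable [set: A] (EFin \o cst (B' - h)).
      exact: (@integrable_prob_kernel _ _ _ _ _ _ _ `|B' - h|).
    transitivity (\int[pi s]_a ((cst (B' - h) a)%:E - (Qt (s, a))%:E))%E.
      apply: eq_integral => a _; rewrite -EFinD -EFinB; congr (_%:E).
      by rewrite addrAC.
    rewrite integralB//.
    rewrite -(EFin_Rintegral_prob_kernel pi s (mQts s) (fun a => QtK (s, a))).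
    rewrite (integral_cst (pi s) measurableT (B' - h)%:E) prob_kernel mule1.
    by rewrite -EFinB -EFinD addrAC.
  + by rewrite (integral_cst (pi s) measurableT +oo%E) prob_kernel mule1.
- move=> x; rewrite -costE adde_ge0 ?soft_cost_ge0// mule_ge0//.
  exact: integral_ge0.
- apply: emeasurable_funB.
    by apply/measurable_EFinP; exact: measurable_funB.
  exact: measurableT_comp (measurable_entropy pi) measurable_fst.
Qed.

(** Gibbs' inequality says precisely that [W] is a subsolution of the cost recursion of [pi]. *)
Lemma total_cost_lower_bound s : (W s <= total_cost p pi D gamma r B s)%E.
Proof.
apply: (total_cost_ge mD gamma01 mr soft_cost_ge0 W0 Ww mW) => {}s.
rewrite cost_bellmanE /W.
have := gibbs_inequality mD lo0 volD mQt QtK s pi_arbiter.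
rewrite soft_maximum_Qt; case: (entropy pi s) => [h||]//=.
  by rewrite -EFinB !lee_fin; lra.
by rewrite leey.
Qed.

Lemma objective_le s : (objective p r gamma pi s <= (V s)%:E)%E.
Proof.
rewrite (objectiveE p mD pi_arbiter gamma01 mr soft_cost_ge0) -/B'.
have := total_cost_lower_bound s; rewrite /W.
case: (total_cost _ _ _ _ _ _ s) => [c||]//=.
- by rewrite -EFinB !lee_fin; lra.
- by rewrite addeNy leNye.
Qed.

(** Cancelling the finite [B'] in the objective identifies the total cost with [W]; one Bellman step
    then yields [r + gamma * E V], which is [Qs] by the fixed-point equation. *)
Lemma soft_value_of_objective :
  (forall s, objective p r gamma pi s = (V s)%:E) ->
  forall x, graph_of D x -> soft_value p r gamma pi x = (Qs x)%:E.
Proof.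
move=> objV x Dx.
rewrite (soft_valueE p mD pi_arbiter gamma01 mr soft_cost_ge0)//.
have tcE s : total_cost p pi D gamma r B s = W s.
  have := objV s.
  rewrite (objectiveE p mD pi_arbiter gamma01 mr soft_cost_ge0) -/B' /W.
  case: (total_cost _ _ _ _ _ _ s) => //= c; rewrite -EFinB => -[<-].
  by rewrite opprB addrC subrK.
under eq_integral do rewrite tcE.
have -> : Qs x = r x + gamma * \int[p x]_s V s by rewrite -fixQs.
rewrite integral_W -EFinM -EFinB; congr (_%:E).
by rewrite /B'; ring.
Qed.

End arbiter_policy.

(** * Attainment by the softmax policy, and the soft value of all optimal policies *)

Let pis := softmax_policy mD lo0 volD mQt QtK.

(** Equality in Gibbs' principle makes [W] a supersolution as well, so the total cost is exactly
    [W]. *)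
Lemma objective_softmax_policy s : objective p r gamma pis s = (V s)%:E.
Proof.
have arb : arbiter D pis by exact: arbiter_softmax_policy.
have cost0 := soft_cost_ge0 arb.
have le : (total_cost p pis D gamma r B s <= W s)%E.
  apply: (total_cost_le mD gamma01 mr cost0 W0 mW) => {}s.
  rewrite cost_bellmanE// entropy_softmax_policy soft_maximum_Qt -EFinB lee_fin.
  by rewrite opprB addrA subrK.
have := total_cost_lower_bound arb s.
rewrite (objectiveE p mD arb gamma01 mr cost0) -/B'.
have /eqP -> : total_cost p pis D gamma r B s == W s.
  by rewrite eq_le le total_cost_lower_bound.
by move=> _; rewrite /W -EFinB opprB addrC subrK.
Qed.

Lemma optimal_softmax_policy : optimal_arbiter p r gamma D pis.
Proof.
split=> [|pi' arb s]; first exact: arbiter_softmax_policy.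
by rewrite objective_softmax_policy objective_le.
Qed.

(** The objective of [pi] is squeezed between that of the softmax policy, which is [V], and the
    general upper bound [V]. *)
Lemma soft_value_optimal_arbiter (pi : policy S nu) :
  optimal_arbiter p r gamma D pi ->
  forall x, graph_of D x -> soft_value p r gamma pi x = (Qs x)%:E.
Proof.
move=> [arb opt]; apply: soft_value_of_objective => // s.
apply/eqP; rewrite eq_le objective_le//= -objective_softmax_policy.
exact/opt/arbiter_softmax_policy.
Qed.


End optimal_policy.

(* There are [n.+1] subtasks; [ord_max] is the one of lowest priority. *)
Theorem theorem3p1 (R : realType) (dS dA : measure_display)
    (S : measurableType dS) (A : measurableType dA)
    (nu : {sigma_finite_measure set A -> \bar R})
    (p : R.-pker (S * A) ~> S) (gamma : R)
    (n : nat) (r : 'I_n.+1 -> S * A -> R)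
    (q : 'I_n -> S * A -> R) (eps : 'I_n -> R) (Q0 : S * A -> R)
    (gamma01 : 0 <= gamma < 1)
    (mr : measurable_fun [set: S * A] (r ord_max))
    (br : [bounded r ord_max x | x in graph_of (indifference q eps)])
    (qmax : forall i s, exists a, forall a', q i (s, a') <= q i (s, a))
    (eps0 : forall i, 0 <= eps i)
    (ne : forall s, indifference q eps s !=set0)
    (mD : measurable (graph_of (indifference q eps)))
    (finD : finite_volume nu (indifference q eps))
    (mQ0 : measurable_fun (graph_of (indifference q eps)) Q0)
    (bQ0 : [bounded Q0 x | x in graph_of (indifference q eps)]) :
  let D := indifference q eps in
  let Q l := iter l (soft_backup nu p (r ord_max) gamma D) Q0 in
  (exists pi : policy S nu, optimal_arbiter p (r ord_max) gamma D pi) /\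
  forall pi : policy S nu, optimal_arbiter p (r ord_max) gamma D pi ->
    forall e : R, 0 < e -> \forall l \near \oo,
      forall s a, D s a ->
        (`| (Q l (s, a))%:E - soft_value p (r ord_max) gamma pi (s, a) |
          <= e%:E)%E.
Proof.
have [lo [hi [lo0 volD]]] := finD; have [r0 [_ rM]] := br.
have [q0 [_ qM]] := bQ0; have /andP[gamma0 gamma1] := gamma01.
move=> D Q; pose L := log_volume_bound lo hi.
pose rmax := Num.max 0 (r0 + 1).
(* The first entry bounds [Q0]; the second is the least radius with
   [rmax + gamma * (K + L) <= K]. *)
pose K := Num.max (q0 + 1) ((rmax + gamma * L) / (1 - gamma)).
have rmax0 : 0 <= rmax by rewrite le_max lexx.
have rb x : graph_of D x -> `|r ord_max x| <= rmax.
  by apply: rM; rewrite lt_max ltrDl ltr01 orbT.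
have stable : rmax + gamma * (K + L) <= K.
  have : (rmax + gamma * L) / (1 - gamma) <= K by rewrite le_max lexx orbT.
  by rewrite ler_pdivrMr ?subr_gt0//; lra.
have gQ0 : admissible D K Q0.
  split=> //; apply: qM; rewrite lt_max; apply/orP; left.
  by rewrite ltrDl.
have [Qs [gQs fixQs QlQs]] :=
  soft_backup_fixpoint mD lo0 volD p gamma01 mr rb stable gQ0.
split.
  eexists; exact: (optimal_softmax_policy mD lo0 volD gamma01 mr rmax0 rb stable
    gQs fixQs).
move=> pi opt e e0.
have geo : gamma ^+ l * (K + K) @[l --> \oo] --> 0.
  rewrite -[X in _ --> X](mul0r (K + K)); apply: cvgM; last exact: cvg_cst.
  by apply: cvg_expr; rewrite ger0_norm.
(* The rate involves neither [s] nor [a], so a single threshold for [l] works for all pairs. *)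
have : \forall l \near \oo, gamma ^+ l * (K + K) <= e.
  exact: cvgr_le geo e e0.
apply: filterS => l le_e s a Dsa.
rewrite (soft_value_optimal_arbiter mD lo0 volD gamma01 mr rmax0 rb stable gQs
  fixQs opt)// -EFinB abse_EFin lee_fin.
exact: le_trans (QlQs l (s, a) Dsa) le_e.
Qed.
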